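(* Let $\rho,\mu,g,v,w>0$ and $0<r_{\min}<r_{\max}<\infty$ be constants, let $\mathcal{F}$ be a positive continuous function on $[r_{\min},r_{\max}]$ (and zero elsewhere), and for each $r\in[r_{\min},r_{\max}]$ let $z_t(r)$ be the solution on $t\ge0$ of $$\tfrac43\pi r^3\rho\,z_t''(r)=-\tfrac43\pi r^3\rho\,g+6\pi\mu r\,(w-z_t'(r)),\qquad z_0(r)=0,\quad z_0'(r)=v .$$ Let $r_{cr}(w)=\sqrt{\dfrac{9\mu w}{2\rho g}}$, and let $\zeta(r)$ and $m(z)$ be the duration and mean function defined in the context. (1) (Subcritical) If $r_{cr}(w)<r_{\min}$, then every droplet returns to the surface in finite time, i.e. $\zeta(r)<\infty$ for all $r\in[r_{\min},r_{\max}]$; the maximum height $\max_{0\le t\le\zeta(r)}z_t(r)$ is a bounded function of $r\in[r_{\min},r_{\max}]$; and $m(z)$ is a bounded function of $z$ which is constant for all sufficiently large $z$. (2) (Critical) If $r_{\min}\le r_{cr}(w)\le r_{\max}$, then $m(z)=\infty$ for all sufficiently large $z$. (3) (Supercritical) If $r_{\max}<r_{cr}(w)$, then $m(z)<\infty$ for every $z>0$ and $\lim_{z\to\infty}m(z)=\infty$.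
   Context: The duration is $\zeta(r)=\inf\{t>0\mid z_t(r)=0\}$, with $\zeta(r)=\infty$ if there is no such $t$; a droplet that returns to height $0$ is removed and contributes nothing afterwards, and its radius is constant equal to $r$ during its flight. Accordingly the mean function is, for $z>0$, $$m(z)=\tfrac43\pi\rho\int_{r_{\min}}^{r_{\max}}\int_0^{\zeta(r)}r^3\,1_{(0,z]}(z_t(r))\,\mathcal{F}(r)\,dt\,dr\in[0,\infty],$$ where $1_{(0,z]}$ is the indicator function of $(0,z]$. *)

(* Defs.v *)
From HB Require Import structures.
From mathcomp Require Import all_boot all_order all_algebra.
From mathcomp Require Import all_classical all_reals all_analysis.
Import Order.TTheory GRing.Theory Num.Theory.
Import numFieldNormedType.Exports.

Set Implicit Arguments.
Unset Strict Implicit.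
Unset Printing Implicit Defensive.

Local Open Scope classical_set_scope.
Local Open Scope ring_scope.

(* [f] has derivative [l] at [t] relative to [D]: with D = [0, +oo[ this is the
   two-sided derivative at t > 0 and the right derivative at t = 0, so that
   nothing is assumed about the values of [f] at negative times. *)
Definition has_derivative_on (R : realType) (D : set R) (f : R -> R)
    (t l : R) : Prop :=
  (f s - f t) / (s - t) @[s --> within D t^'] --> l.

Definition droplet_motion (R : realType) (rho mu g v w r : R) (h : R -> R)
    : Prop :=
  exists dh ddh : R -> R,
    [/\ h 0 = 0,
        dh 0 = v,
        forall t : R, 0 <= t -> has_derivative_on `[0, +oo[ h t (dh t),
        forall t : R, 0 <= t -> has_derivative_on `[0, +oo[ dh t (ddh t)
      & forall t : R, 0 <= t ->
          4 / 3 * pi * r ^+ 3 * rho * ddh t =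
          - (4 / 3 * pi * r ^+ 3 * rho * g) + 6 * pi * mu * r * (w - dh t)].

Definition critical_radius (R : realType) (rho mu g w : R) : R :=
  Num.sqrt (9 * mu * w / (2 * rho * g)).

(* In the next definitions [z t r] is the height z_t(r). The infimum of the
   empty set in \bar R is +oo. *)
Definition duration (R : realType) (z : R -> R -> R) (r : R) : \bar R :=
  ereal_inf [set t%:E | t in [set t : R | 0 < t /\ z t r = 0]].

Definition flight_times (R : realType) (z : R -> R -> R) (r : R) : set R :=
  [set t : R | 0 <= t /\ (t%:E <= duration z r)%E].

Definition is_max_on (R : realType) (D : set R) (f : R -> R) (h : R) : Prop :=
  (exists2 t, D t & f t = h) /\ (forall t : R, D t -> f t <= h).

Definition mean_function (R : realType) (rho rmin rmax : R) (F : R -> R)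
    (z : R -> R -> R) (x : R) : \bar R :=
  ((4 / 3 * pi * rho)%:E *
   \int[lebesgue_measure]_(r in `[rmin, rmax])
     \int[lebesgue_measure]_(t in flight_times z r)
       (r ^+ 3 * \1_(`]0, x]%classic : set R) (z t r) * F r)%:E)%E.

(* Main.v *)
Require Import Defs.
From HB Require Import structures.
From mathcomp Require Import all_boot all_order all_algebra.
From mathcomp Require Import all_classical all_reals all_analysis.
From mathcomp Require Import measurable_realfun ring lra.
Import Order.TTheory GRing.Theory Num.Theory.
Import numFieldNormedType.Exports.

Local Open Scope classical_set_scope.
Local Open Scope ring_scope.

Set Implicit Arguments.
Unset Strict Implicit.
Unset Printing Implicit Defensive.

(** With the drag rate k = 9 mu / (2 rho r^2) and the terminal velocity
    c = w - g / k, the solution is z_t = c t + (v - c) phi, i.e.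
    z_t = c (t - phi) + v phi, where phi = (1 - e^(-k t)) / k satisfies
    t / (1 + k t) <= phi <= min (t, 1 / k). Moreover
    k c = (g / r^2) (rcr^2 - r^2), so the sign of c decides the regime.
    - If c <= -s < 0 uniformly in r, then z_t <= v / k - s (t - 1 / k): the
      flights end before a common time and stay below a common height.
    - If c is uniformly positive, z_t lies between two positive multiples of
      t, so the time spent below x, hence m(x), is of exact order x.
    - Whatever the sign of c, 0 < z_t <= 2 v / k as long as k |c| t < v. Near
      rcr the droplet thus spends a time of order 1 / |r - rcr| below a fixed
      height, and 1 / |r - rcr| is not integrable. *)

(** * One-sided derivatives and the linear relaxation equation *)

(** When [D] is a neighbourhood of [t], restricting to [D] does not change the limit, and s = h + t
    turns one difference quotient into the other. *)
Lemma has_derivative_on_is_derive (R : realType) (D : set R) (f : R -> R)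
    (t l : R) :
  nbhs t D -> has_derivative_on D f t l -> is_derive t 1 f l.
Proof.
move=> Dt fl.
have cl : h^-1 *: (f (h *: 1 + t) - f t) @[h --> 0^'] --> l.
  have st : (h + t) @[h --> 0^'] --> within D t^'.
    move=> A; rewrite /within /dnbhs /within /= => DA.
    have {}DA : nbhs (0 + t) (fun s => s != t -> D s -> A s) by rewrite add0r.
    rewrite -[t]add0r in Dt.
    have st : (fun h : R => h + t) @ (0 : R) --> 0 + t.
      by apply: cvgD; [exact: cvg_id|exact: cvg_cst].
    have H : nbhs (0 : R) (fun h => h + t != t -> A (h + t)).
      apply: (@filterS2 R (nbhs (0 : R)) _ _ _ _ _ (st _ DA) (st _ Dt)).
      by move=> h /= H Dh ht; exact: H.
    apply: (@filterS R (nbhs (0 : R)) _ _ _ _ H) => h /= + h0; apply.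
    by rewrite -subr_eq0 addrK.
  have := cvg_comp _ _ st fl; apply: cvg_trans.
  apply: near_eq_cvg; near=> h => /=.
  by rewrite addrK mulrC scaler1.
apply: DeriveDef; first by apply/cvg_ex; exists l.
exact/cvg_lim.
Unshelve. all: by end_near. Qed.

(** Near [t] the difference quotients are bounded by |df t| + 1, so on [D] one has |f s - f t| <=
    (|df t| + 1) |s - t|. *)
Lemma has_derivative_on_within_continuous (R : realType) (D : set R)
    (f df : R -> R) :
  (forall t, D t -> has_derivative_on D f t (df t)) ->
  {within D, continuous f}.
Proof.
move=> fdf; apply/subspace_continuousP => t Dt.
have fl := fdf t Dt.
apply/cvgrPdist_lt => e e0.
move/cvgrPdist_lt : fl => /(_ 1 ltr01).
rewrite /within /dnbhs /within /= => H.
have K0 : 0 < `|df t| + 1 by rewrite ltr_wpDl.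
have H2 : \forall s \near t, `|t - s| < e / (`|df t| + 1).
  by apply: nbhsx_ballx; rewrite divr_gt0.
apply: (@filterS2 R (nbhs t) _ _ _ _ _ H H2) => s /= {}H {}H2 Ds.
have [->|st] := eqVneq s t; first by rewrite subrr normr0.
move: H => /(_ st Ds) H.
have s0 : s - t != 0 by rewrite subr_eq0.
have -> : f t - f s = ((f s - f t) / (s - t)) * (t - s) by field.
rewrite normrM.
have H3 : `|(f s - f t) / (s - t)| < `|df t| + 1.
  rewrite -ltrBlDl (le_lt_trans _ H)// -normrN opprB.
  exact: lerB_dist.
have := H2; rewrite ltr_pdivlMr// => H4.
apply: le_lt_trans H4; rewrite mulrC; apply: ler_wpM2l => //; exact: ltW.
Qed.

(** Mean value theorem. Only continuity is asked at the end points, which suits motions with a mere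
    right derivative at time 0. *)
Lemma is_derive0_cst_segment (R : realType) (f : R -> R) (a b : R) :
  a <= b -> (forall x, x \in `]a, b[%R -> is_derive x 1 f 0) ->
  {within `[a, b], continuous f} -> f b = f a.
Proof.
move=> ab df cf.
have [c _ /eqP] := @MVT_segment R f (cst 0) a b ab df cf.
by rewrite mul0r subr_eq0 => /eqP.
Qed.


(** Integrating factor: (f - c) e^(k t) has derivative zero, hence is constant. *)
Lemma linear_relaxation (R : realType) (k c : R) (f df : R -> R) :
  (forall t : R, 0 <= t -> has_derivative_on `[0, +oo[ f t (df t)) ->
  (forall t : R, 0 <= t -> df t = k * (c - f t)) ->
  forall t : R, 0 <= t -> f t = c + (f 0 - c) * expR (- (k * t)).
Proof.
move=> fdf dfE t t0.
pose u : R -> R := (f - cst c) * (expR \o ( *%R k)).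
have utu0 : u t = u 0.
  apply: is_derive0_cst_segment => // [x|].
    rewrite in_itv/= => /andP[x0 xt].
    have dfx : is_derive x 1 f (df x).
      apply: (@has_derivative_on_is_derive _ `[0, +oo[);
        last exact: fdf (ltW _).
      apply: (@filterS R (nbhs x) _ _ _ _ (lt_nbhsr x0)) => y /= /ltW.
      by rewrite in_itv/= andbT.
    rewrite /u; apply: is_derive_eq.
    rewrite dfE ?(ltW x0)// !fctE /= /GRing.scale/=; ring.
  have cf : {within `[0, t], continuous f}.
    apply: (@continuous_subspaceW R R `[0, t] `[0, +oo[ f).
      by move=> x /=; rewrite !in_itv/= andbT => /andP[].
    apply: (@has_derivative_on_within_continuous _ _ _ df) => x /=.
    by rewrite in_itv/= andbT; exact: fdf.
  move: cf => /subspace_continuousP cf; apply/subspace_continuousP => x xt.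
  apply: cvgM; first by apply: cvgB; [exact: cf|exact: cvg_cst].
  apply: cvg_within_filter.
  apply: continuous_comp; last exact: continuous_expR.
  exact: mulrl_continuous.
move: utu0; rewrite /u !fctE/= mulr0 expR0 mulr1 => <-.
by rewrite -mulrA expRxMexpNx_1; ring.
Qed.

(** * Bounds on the explicit solution *)

(** The function phi of the overview: for nonzero k, the integral of e^(-k s) for s from 0 to t. *)
Definition damped_time (R : realType) (k t : R) : R :=
  (1 - expR (- (k * t))) / k.

Lemma damped_time_le (R : realType) (k t : R) : 0 < k -> damped_time k t <= t.
Proof.
move=> k0; rewrite /damped_time ler_pdivrMr//.
have := expR_ge1Dx (- (k * t)); nra.
Qed.

Lemma damped_time_le_inv (R : realType) (k t : R) :
  0 < k -> damped_time k t <= k^-1.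
Proof.
by move=> k0; rewrite /damped_time -[leRHS]mul1r ler_pM2r ?invr_gt0// lerBlDr
  lerDl expR_ge0.
Qed.

Lemma damped_time_gt0 (R : realType) (k t : R) :
  0 < k -> 0 < t -> 0 < damped_time k t.
Proof.
move=> k0 t0; rewrite divr_gt0// subr_gt0 expR_lt1 oppr_lt0.
exact: mulr_gt0.
Qed.

(** From e^(k t) >= 1 + k t follows e^(-k t) (1 + k t) <= 1; the claim is a rearrangement. *)
Lemma damped_time_ge (R : realType) (k t : R) :
  0 < k -> 0 <= t -> t <= damped_time k t * (1 + k * t).
Proof.
move=> k0 t0; rewrite /damped_time mulrAC ler_pdivlMr//.
have e1 := expR_ge1Dx (k * t).
have e2 : expR (- (k * t)) * (1 + k * t) <= 1.
  by rewrite -[leRHS](expRxMexpNx_1 (k * t)) [leRHS]mulrC ler_pM2l ?expR_gt0.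
lra.
Qed.

(** The bounds below read this as c (t - p) + v p with p = [damped_time k t]; for k > 0 and t >= 0
    both weights t - p and p are nonnegative. *)
Definition flight_height (R : realType) (k c v t : R) : R :=
  c * t + (v - c) * damped_time k t.

(** The worst case is c = - |c|. Since t - p <= k t p, the height is at least p (v - k |c| t). *)
Lemma flight_height_gt0 (R : realType) (k c v t : R) :
  0 < k -> 0 < t -> k * `|c| * t < v -> 0 < flight_height k c v t.
Proof.
move=> k0 t0 tv.
have p0 := damped_time_gt0 k0 t0.
have p1 := damped_time_ge k0 (ltW t0).
have p2 := damped_time_le t k0.
rewrite /flight_height; set p := damped_time k t in p0 p1 p2 *.
have cl : - `|c| <= c by rewrite lerNl -normrN ler_norm.
have c0 := normr_ge0 c.
have h1 : - `|c| * (t - p) <= c * (t - p) by apply: ler_wpM2r => //; lra.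
have h2 : `|c| * (t - p) <= `|c| * (p * (k * t)) by apply: ler_wpM2l => //; lra.
have h3 : 0 < p * (v - k * `|c| * t) by apply: mulr_gt0 => //; lra.
lra.
Qed.

Lemma flight_height_le (R : realType) (k c v t : R) :
  0 < k -> 0 < v -> 0 <= t -> flight_height k c v t <= `|c| * t + v / k.
Proof.
move=> k0 v0 t0.
have p2 := damped_time_le t k0.
have p3 := damped_time_le_inv t k0.
have p0 : 0 <= damped_time k t.
  have [->|t1] := eqVneq t 0.
    by rewrite /damped_time mulr0 oppr0 expR0 subrr mul0r.
  by apply/ltW/damped_time_gt0 => //; rewrite lt_def t1.
rewrite /flight_height; set p := damped_time k t in p0 p2 p3 *.
have cl := ler_norm c.
have c0 := normr_ge0 c.
have h1 : c * (t - p) <= `|c| * (t - p) by apply: ler_wpM2r => //; lra.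
have h2 : v * p <= v / k by exact: ler_wpM2l (ltW v0) _ _ p3.
have h3 : 0 <= `|c| * p by apply: mulr_ge0.
lra.
Qed.

(** The weights t - p and p add up to t, so the height lies between min(c, v) t and max(c, v) t; the
    next lemma is the upper half. *)
Lemma flight_height_ge_linear (R : realType) (k c v s t : R) :
  0 < k -> s <= c -> s <= v -> 0 < t -> s * t <= flight_height k c v t.
Proof.
move=> k0 sc sv t0.
have p2 := damped_time_le t k0.
have p0 := damped_time_gt0 k0 t0.
rewrite /flight_height; set p := damped_time k t in p0 p2 *.
nra.
Qed.

Lemma flight_height_le_linear (R : realType) (k c v s t : R) :
  0 < k -> c <= s -> v <= s -> 0 < t -> flight_height k c v t <= s * t.
Proof.
move=> k0 sc sv t0.
have p2 := damped_time_le t k0.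
have p0 := damped_time_gt0 k0 t0.
rewrite /flight_height; set p := damped_time k t in p0 p2 *.
nra.
Qed.

(** Here c (t - p) <= - s (t - p), and p <= 1 / k bounds both v p and s p. *)
Lemma flight_height_le_falling (R : realType) (k c v s t : R) :
  0 < k -> 0 < v -> 0 <= s -> c <= - s -> 0 < t ->
  flight_height k c v t <= v / k - s * (t - k^-1).
Proof.
move=> k0 v0 s0 sc t0.
have p2 := damped_time_le t k0.
have p3 := damped_time_le_inv t k0.
have p0 := damped_time_gt0 k0 t0.
rewrite /flight_height; set p := damped_time k t in p0 p2 p3 *.
have h1 : 0 <= (- s - c) * (t - p) by apply: mulr_ge0; lra.
have h2 : v * p <= v / k by exact: ler_wpM2l (ltW v0) _ _ p3.
have h3 : s * p <= s / k by exact: ler_wpM2l s0 _ _ p3.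
lra.
Qed.

Lemma flight_height_le_bounded (R : realType) (k c v t : R) :
  0 < k -> 0 < v -> c <= 0 -> 0 < t -> flight_height k c v t <= v / k.
Proof.
move=> k0 v0 c0 t0.
rewrite (le_trans (flight_height_le_falling k0 v0 (lexx 0) _ t0))//; lra.
Qed.

(** * Solving the equation of motion *)

(** The Stokes drag coefficient 6 pi mu r divided by the mass (4/3) pi r^3 rho. *)
Definition drag_rate (R : realType) (rho mu r : R) : R :=
  9 * mu / (2 * rho * r ^+ 2).

Definition terminal_velocity (R : realType) (rho mu g w r : R) : R :=
  w - g / drag_rate rho mu r.

Lemma drag_rate_gt0 (R : realType) (rho mu r : R) :
  0 < rho -> 0 < mu -> 0 < r -> 0 < drag_rate rho mu r.
Proof. by move=> *; rewrite divr_gt0 ?mulr_gt0 ?exprn_gt0. Qed.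

Lemma droplet_within_continuous (R : realType) (rho mu g v w r : R)
    (h : R -> R) (A : set R) :
  droplet_motion rho mu g v w r h -> A `<=` `[0, +oo[ ->
  {within A, continuous h}.
Proof.
move=> [dh [ddh [_ _ hdh _ _]]] AD.
apply: (continuous_subspaceW AD).
apply: (@has_derivative_on_within_continuous _ _ _ dh) => x /=.
by rewrite in_itv/= andbT; exact: hdh.
Qed.

(** Division by the mass turns the equation into relaxation of the velocity towards c at rate k,
    which determines [dh]. The height and the closed formula then have the same derivative, and both
    vanish at 0. *)
Lemma droplet_height (R : realType) (rho mu g v w r : R) (h : R -> R) :
  0 < rho -> 0 < mu -> 0 < r ->
  droplet_motion rho mu g v w r h ->
  forall t : R, 0 <= t ->
    h t = flight_height (drag_rate rho mu r)
            (terminal_velocity rho mu g w r) v t.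
Proof.
move=> rho0 mu0 r0 /[dup] motion [dh [ddh [h0 dh0 hdh dhddh ode]]].
have k0 := drag_rate_gt0 rho0 mu0 r0.
set k := drag_rate rho mu r in k0 *; set c := terminal_velocity rho mu g w r.
have ddhE (t : R) : 0 <= t -> ddh t = k * (c - dh t).
  move=> t0; have := ode t t0.
  have pi0 : (0:R) < pi := pi_gt0 R.
  have K0 : 4 / 3 * pi * r ^+ 3 * rho != 0.
    by rewrite !mulf_neq0 ?expf_neq0 ?gt_eqF// invr_gt0.
  move=> E; apply: (mulfI K0).
  rewrite E /c /k /terminal_velocity /drag_rate; field.
  by rewrite !gt_eqF.
have dhE (t : R) : 0 <= t -> dh t = c + (v - c) * expR (- (k * t)).
  by move=> t0; rewrite -dh0; exact: linear_relaxation dhddh ddhE t t0.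
move=> T T0.
pose u : R -> R := h - flight_height k c v.
have dflight (x : R) : is_derive x 1 (flight_height k c v)
    (c + (v - c) * expR (- (k * x))).
  have de : is_derive x 1 (expR \o ( *%R (- k))) (expR (- k * x) * - k).
    apply: is_derive1_comp; apply: is_derive_eq.
    by rewrite /GRing.scale/= mulr1.
  rewrite (_ : flight_height k c v = (c *: id) +
      ((v - c) / k) *: (cst 1 - (expR \o ( *%R (- k))))); last first.
    apply/funext => y; rewrite /flight_height /damped_time !fctE /= mulNr.
    by rewrite /GRing.scale/=; ring.
  apply: is_derive_eq; rewrite /GRing.scale/= mulNr sub0r; field.
  by rewrite gt_eqF.
have : u T = u 0.
  apply: is_derive0_cst_segment => // [x|].
    rewrite in_itv/= => /andP[x0 xT].
    have dhx : is_derive x 1 h (dh x).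
      apply: (@has_derivative_on_is_derive _ `[0, +oo[);
        last exact: hdh (ltW _).
      apply: (@filterS R (nbhs x) _ _ _ _ (lt_nbhsr x0)) => y /= /ltW.
      by rewrite in_itv/= andbT.
    apply: is_derive_eq.
    by rewrite dhE ?subrr// ltW.
  have ch : {within `[0, T], continuous h}.
    apply: (droplet_within_continuous motion) => x /=.
    by rewrite !in_itv/= andbT => /andP[].
  move: ch => /subspace_continuousP ch; apply/subspace_continuousP => x xT.
  apply: cvgB; first exact: ch.
  apply: cvg_within_filter.
  apply/differentiable_continuous/derivable1_diffP.
  exact: (@ex_derive _ _ _ _ _ _ _ (dflight x)).
have f0 : flight_height k c v 0 = 0.
  rewrite /flight_height /damped_time !mulr0 oppr0 expR0 subrr mul0r.
  by rewrite mulr0 addr0.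
by rewrite /u !fctE h0 f0 subrr => /eqP; rewrite subr_eq0 => /eqP.
Qed.

(** * Monotonicity of integrals of nonnegative functions *)

(* The integral of a nonnegative function is a supremum over simple minorants,
   so it is monotone without any measurability assumption; this spares the
   measurability in [r] of the inner integral of [mean_function]. *)
Lemma le_integral_patch d (T : measurableType d) (R : realType)
    (mu : {measure set T -> \bar R}) (D E : set T) (f g : T -> \bar R) :
  (forall x, D x -> (0 <= f x)%E) -> (forall x, E x -> (0 <= g x)%E) ->
  (forall x, ((f \_ D) x <= (g \_ E) x)%E) ->
  (\int[mu]_(x in D) f x <= \int[mu]_(x in E) g x)%E.
Proof.
move=> f0 g0 fg; rewrite !ge0_integralE//.
apply: le_ereal_sup => _ [h /= hf <-]; exists h => // x.
exact: le_trans (hf x) (fg x).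
Qed.

Lemma ge0_le_integral_subset d (T : measurableType d) (R : realType)
    (mu : {measure set T -> \bar R}) (D E : set T) (f g : T -> \bar R) :
  D `<=` E -> (forall x, D x -> (0 <= f x)%E) ->
  (forall x, E x -> (0 <= g x)%E) -> (forall x, D x -> (f x <= g x)%E) ->
  (\int[mu]_(x in D) f x <= \int[mu]_(x in E) g x)%E.
Proof.
move=> DE f0 g0 fg; apply: le_integral_patch => // x; rewrite /patch.
case: ifPn => [/set_mem Dx|_]; first by rewrite mem_set ?fg//; exact: DE.
by case: ifPn => // /set_mem; exact: g0.
Qed.

(** * Divergence of the integral of 1 / |r - a| *)

(** The inverse is written as the real power -1, which is measurable; at r = a both take the default
    value 0. *)
Lemma measurable_inv_dist (R : realType) (a : R) (A : set R) : measurable A ->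
  measurable_fun A (fun r : R => (`|r - a|^-1)%:E).
Proof.
move=> mA; apply/measurable_EFinP.
rewrite (_ : (fun r => _) =
    (fun r : R => r `^ (-1)) \o (fun r => `|r - a|)); last first.
  by apply/funext => r /=; rewrite powR_inv1.
apply: measurableT_comp; first exact: measurable_powR.
apply: measurableT_comp; first exact: normr_measurable.
exact: measurable_funB.
Qed.

(* Each of the disjoint shells [I d `\` I (d / 2)] contributes at least 1/2. *)
Lemma integral_inv_dist_dyadic (R : realType) (a : R) (I : R -> set R) :
  (forall d : R, measurable (I d)) ->
  (forall d r : R, I d r -> 0 < `|r - a| <= d) ->
  (forall d : R, 0 < d -> I (d / 2) `<=` I d) ->
  (forall d : R, 0 < d -> lebesgue_measure (I d `\` I (d / 2)) = (d / 2)%:E) ->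
  forall d : R, 0 < d ->
    (\int[lebesgue_measure]_(r in I d) (`|r - a|^-1)%:E = +oo)%E.
Proof.
move=> mI Id I2 mu2.
(* The bound n / 2 is stated for all d at once because the induction passes from d to d / 2. *)
suff H (n : nat) : forall d : R, 0 < d ->
    ((n%:R / 2)%:E <= \int[lebesgue_measure]_(r in I d) (`|r - a|^-1)%:E)%E.
  move=> d d0; apply/eqyP => A A0.
  (* This n exceeds 2 A, so n / 2 exceeds the arbitrary bound A. *)
  apply: le_trans (H (Num.trunc (2 * A)).+1 d d0).
  by rewrite lee_fin ler_pdivlMr// mulrC ltW// truncnS_gt.
have f0 (r : R) : (0 <= (`|r - a|^-1)%:E)%E by rewrite lee_fin invr_ge0.
elim: n => [d d0|n IH d d0].
  by rewrite mul0r; apply: integral_ge0 => r _; exact: f0.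
have mD : measurable (I d `\` I (d / 2)) by exact: measurableD.
rewrite -[in leRHS](setDUK (I2 d d0)) ge0_integral_setU//; last 3 first.
- exact: mI.
- by apply: measurable_inv_dist; exact: measurableU.
- by apply/disj_setPS => r [/= ? [_ ?]].
rewrite -natr1 mulrDl mul1r EFinD; apply: leeD.
  by apply: IH; rewrite divr_gt0.
have -> : ((2^-1)%:E = \int[lebesgue_measure]_(r in I d `\` I (d / 2)%R)
    cst (d^-1)%:E r)%E.
  rewrite integral_cst// [X in (_ * X)%E](mu2 d d0) -EFinM; congr EFin; field.
  exact: lt0r_neq0.
apply: ge0_le_integral_subset => // [r _|r [/Id/andP[r0 rd] _]].
  by rewrite lee_fin invr_ge0 ltW.
by rewrite lee_fin lef_pV2.
Qed.

(** The divergence is needed on each side separately, since the critical radius may be an end point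
    of the range of radii. *)
Lemma integral_inv_dist_right (R : realType) (a d : R) : 0 < d ->
  (\int[lebesgue_measure]_(r in `]a, (a + d)%R[) (`|r - a|^-1)%:E = +oo)%E.
Proof.
apply: (integral_inv_dist_dyadic (I := fun d => `]a, a + d[%classic)) => //.
- move=> {}d r /=; rewrite in_itv/= => /andP[ar rd].
  rewrite gtr0_norm; lra.
- move=> {}d d0 r /=; rewrite !in_itv/= => /andP[-> /= rd]; lra.
- move=> {}d d0.
  rewrite (_ : _ `\` _ = `[a + d / 2, a + d[%classic); last first.
    apply/seteqP; split => r /=; rewrite !in_itv/=.
      by move=> [/andP[-> ->] /= /negP]; rewrite -leNgt andbT.
    move=> /andP[H1 H2]; split; first by apply/andP; split; lra.
    by move=> /andP[_]; rewrite ltNge H1.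
  rewrite lebesgue_measure_itv/= lte_fin ifT; last lra.
  rewrite -EFinB; congr EFin; lra.
Qed.

Lemma integral_inv_dist_left (R : realType) (a d : R) : 0 < d ->
  (\int[lebesgue_measure]_(r in `](a - d)%R, a[) (`|r - a|^-1)%:E = +oo)%E.
Proof.
apply: (integral_inv_dist_dyadic (I := fun d => `](a - d), a[%classic)) => //.
- move=> {}d r /=; rewrite in_itv/= => /andP[ar rd].
  rewrite ltr0_norm; lra.
- move=> {}d d0 r /=; rewrite !in_itv/= => /andP[rd ->]; rewrite andbT; lra.
- move=> {}d d0.
  rewrite (_ : _ `\` _ = `](a - d), (a - d / 2)]%classic); last first.
    apply/seteqP; split => r /=; rewrite !in_itv/=.
      by move=> [/andP[-> ->] /= /negP]; rewrite andbT -leNgt.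
    move=> /andP[H1 H2]; split; first by apply/andP; split; lra.
    by move=> /andP[]; rewrite ltNge H2.
  rewrite lebesgue_measure_itv/= lte_fin ifT; last lra.
  rewrite -EFinB; congr EFin; lra.
Qed.

(** * Dependence of the drag rate and the terminal velocity on the radius *)

Lemma drag_rate_le (R : realType) (rho mu r s : R) :
  0 < rho -> 0 < mu -> 0 < r -> r <= s ->
  drag_rate rho mu s <= drag_rate rho mu r.
Proof.
move=> rho0 mu0 r0 rs; have s0 : 0 < s by exact: lt_le_trans rs.
apply: ler_wpM2l; first by rewrite ltW// mulr_gt0.
rewrite lef_pV2 ?posrE ?mulr_gt0 ?exprn_gt0// ler_pM2l ?mulr_gt0//.
by rewrite ler_pXn2r ?nnegrE// ltW.
Qed.

Lemma terminal_velocity_le (R : realType) (rho mu g w r s : R) :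
  0 < rho -> 0 < mu -> 0 < g -> 0 < r -> r <= s ->
  terminal_velocity rho mu g w s <= terminal_velocity rho mu g w r.
Proof.
move=> rho0 mu0 g0 r0 rs; have s0 : 0 < s by exact: lt_le_trans rs.
rewrite lerD2l lerN2 ler_pM2l// lef_pV2 ?posrE ?drag_rate_gt0//.
exact: drag_rate_le.
Qed.

(** Indeed k c = k w - g, and k w = g rcr^2 / r^2 by the choice of the critical radius. *)
Lemma drag_rate_terminal_velocity (R : realType) (rho mu g w r : R) :
  0 < rho -> 0 < mu -> 0 < g -> 0 < w -> 0 < r ->
  drag_rate rho mu r * terminal_velocity rho mu g w r =
  g / r ^+ 2 * (critical_radius rho mu g w ^+ 2 - r ^+ 2).
Proof.
move=> rho0 mu0 g0 w0 r0.
rewrite /critical_radius sqr_sqrtr; last first.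
  by apply: divr_ge0; rewrite ltW// !mulr_gt0.
rewrite /terminal_velocity /drag_rate; field.
by rewrite !gt_eqF.
Qed.

(** * The contribution of a single radius *)

(** A return time below t < T would be a zero of the height inside ]0, T[, so the duration is at
    least t. *)
Lemma flight_times_sub (R : realType) (z : R -> R -> R) (r T : R) :
  (forall t : R, 0 < t < T -> 0 < z t r) -> `]0, T[ `<=` flight_times z r.
Proof.
move=> zT t /=; rewrite in_itv/= => /andP[t0 tT]; split; first exact: ltW.
apply/ereal_infP => _ [s [s0 zs] <-]; rewrite lee_fin leNgt; apply/negP => st.
by have := zT s; rewrite s0 (lt_trans st)// zs ltxx => /(_ erefl).
Qed.

(** Literally the inner integral of [mean_function], so that bounds proved radius by radius apply to
    it by conversion. *)
Definition flight_integral (R : realType) (F : R -> R) (z : R -> R -> R)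
    (x r : R) : \bar R :=
  (\int[lebesgue_measure]_(t in flight_times z r)
     (r ^+ 3 * \1_(`]0%R, x]%classic : set R) (z t r) * F r)%:E)%E.

Lemma integral_cst_segment (R : realType) (a b B : R) : a <= b ->
  (\int[lebesgue_measure]_(t in `[a, b]) cst B%:E t = (B * (b - a))%:E)%E.
Proof.
move=> ab; rewrite integral_cst//= lebesgue_measure_itv/= lte_fin.
case: ltP => ba; first by rewrite -EFinB -EFinM.
have /eqP -> : b == a by rewrite eq_le ab ba.
by rewrite subrr mulr0 mule0.
Qed.

Lemma integral_cst_itvoo (R : realType) (a b B : R) : a <= b ->
  (\int[lebesgue_measure]_(t in `]a, b[) cst B%:E t = (B * (b - a))%:E)%E.
Proof.
move=> ab; rewrite integral_cst//= lebesgue_measure_itv/= lte_fin.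
case: ltP => ba; first by rewrite -EFinB -EFinM.
have /eqP -> : b == a by rewrite eq_le ab ba.
by rewrite subrr mulr0 mule0.
Qed.

Lemma flight_integral_ge0 (R : realType) (F : R -> R) (z : R -> R -> R)
    (x r : R) : 0 <= r -> 0 <= F r -> (0 <= flight_integral F z x r)%E.
Proof.
move=> r0 F0; apply: integral_ge0 => t _.
by rewrite lee_fin !mulr_ge0// exprn_ge0.
Qed.

Lemma flight_integral_ge (R : realType) (F : R -> R) (z : R -> R -> R)
    (x r T : R) : 0 <= r -> 0 <= F r -> 0 <= T ->
  (forall t : R, 0 < t < T -> 0 < z t r <= x) ->
  ((r ^+ 3 * F r * T)%:E <= flight_integral F z x r)%E.
Proof.
move=> r0 F0 T0 zT; rewrite -[X in (_ * X)%R]subr0 -integral_cst_itvoo//.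
apply: ge0_le_integral_subset => [|t _|t _|t] /=.
- by apply: flight_times_sub => t /zT /andP[].
- by rewrite lee_fin !mulr_ge0// exprn_ge0.
- by rewrite lee_fin !mulr_ge0// exprn_ge0.
- by rewrite in_itv/= => /zT zt; rewrite lee_fin indicE mem_set ?mulr1//=.
Qed.

(** [T] need only bound the times spent in ]0, x], not the whole flight; this is what covers flights
    that never end. *)
Lemma flight_integral_le (R : realType) (F : R -> R) (z : R -> R -> R)
    (x r T : R) : 0 <= r -> 0 <= F r -> 0 <= T ->
  (forall t : R, flight_times z r t -> 0 < z t r <= x -> t <= T) ->
  (flight_integral F z x r <= (r ^+ 3 * F r * T)%:E)%E.
Proof.
move=> r0 F0 T0 zT; rewrite -[X in (_ * X)%R]subr0 -integral_cst_segment//.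
have C0 : 0 <= r ^+ 3 * F r by rewrite !mulr_ge0// exprn_ge0.
apply: le_integral_patch => [t _|t _|t] /=.
- by rewrite lee_fin !mulr_ge0// exprn_ge0.
- by rewrite lee_fin.
- rewrite /patch; case: ifPn => [/set_mem zt|_];
    last by case: ifPn; rewrite ?lee_fin.
  rewrite indicE; case: ifPn => [_|].
    by rewrite lee_fin -mulrA mulrCA mulrC ler_piMr// ?ler1n ?lern1 ?leq_b1.
  rewrite notin_setE/= in_itv/= => tT.
  rewrite memNset ?mulr0 ?mul0r//= in_itv/= => z0; apply: tT.
  by rewrite (zT _ zt z0) andbT; case: zt.
Qed.

(** * From bounds at each radius to bounds on the mean function *)

Lemma mean_constant_gt0 (R : realType) (rho : R) :
  0 < rho -> 0 < 4 / 3 * pi * rho.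
Proof. by move=> rho0; rewrite !mulr_gt0 ?invr_gt0 ?pi_gt0. Qed.

Lemma mean_function_ge0 (R : realType) (rho rmin rmax : R) (F : R -> R)
    (z : R -> R -> R) (x : R) : 0 < rho -> 0 < rmin ->
  (forall r : R, rmin <= r <= rmax -> 0 <= F r) ->
  (0 <= mean_function rho rmin rmax F z x)%E.
Proof.
move=> rho0 rmin0 F0.
apply: mule_ge0; first by rewrite lee_fin ltW// mean_constant_gt0.
apply: integral_ge0 => r /=; rewrite in_itv/= => rr.
apply: flight_integral_ge0; last exact: F0.
by case/andP: rr => /(le_trans (ltW rmin0)).
Qed.

(** Radii outside [D] are dropped, the integrand being nonnegative; the critical case takes for [D]
    a one-sided neighbourhood of the critical radius. *)
Lemma mean_function_ge (R : realType) (rho rmin rmax : R) (F : R -> R)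
    (z : R -> R -> R) (x : R) (D : set R) (b : R -> R) : 0 < rho -> 0 < rmin ->
  (forall r : R, rmin <= r <= rmax -> 0 <= F r) ->
  D `<=` `[rmin, rmax] -> (forall r, D r -> 0 <= b r) ->
  (forall r, D r -> ((b r)%:E <= flight_integral F z x r)%E) ->
  ((4 / 3 * pi * rho)%:E * \int[lebesgue_measure]_(r in D) (b r)%:E <=
   mean_function rho rmin rmax F z x)%E.
Proof.
move=> rho0 rmin0 F0 DE b0 bf.
apply: lee_wpmul2l; first by rewrite lee_fin ltW// mean_constant_gt0.
apply: ge0_le_integral_subset => // r.
rewrite /= in_itv/= => rr; apply: flight_integral_ge0; last exact: F0.
by case/andP: rr => /(le_trans (ltW rmin0)).
Qed.

Lemma mean_function_le (R : realType) (rho rmin rmax : R) (F : R -> R)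
    (z : R -> R -> R) (x B : R) : 0 < rho -> 0 < rmin -> rmin <= rmax ->
  (forall r : R, rmin <= r <= rmax -> 0 <= F r) -> 0 <= B ->
  (forall r, rmin <= r <= rmax -> (flight_integral F z x r <= B%:E)%E) ->
  (mean_function rho rmin rmax F z x <=
   (4 / 3 * pi * rho * (B * (rmax - rmin)))%:E)%E.
Proof.
move=> rho0 rmin0 rr F0 B0 Bf; rewrite EFinM -integral_cst_segment//.
apply: lee_wpmul2l; first by rewrite lee_fin ltW// mean_constant_gt0.
apply: ge0_le_integral_subset => // r; rewrite /= in_itv/=.
move=> rI; apply: flight_integral_ge0; last exact: F0.
by case/andP: rI => /(le_trans (ltW rmin0)).
Qed.

Lemma ler_gt0X (R : realFieldType) (x y : R) (n : nat) :
  0 < x -> x <= y -> x ^+ n <= y ^+ n.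
Proof.
move=> x0 xy; apply: lerXn2r => //; rewrite nnegrE ltW//.
exact: lt_le_trans xy.
Qed.

Lemma mean_function_eq_pinfty (R : realType) (rho rmin rmax : R) (F : R -> R)
    (z : R -> R -> R) (x a B : R) : 0 < rho -> 0 < rmin -> rmin < rmax ->
  rmin <= a <= rmax -> 0 < B ->
  (forall r : R, rmin <= r <= rmax -> 0 <= F r) ->
  (forall r : R, rmin <= r <= rmax -> r != a ->
     ((B * `|r - a|^-1)%:E <= flight_integral F z x r)%E) ->
  mean_function rho rmin rmax F z x = +oo%E.
Proof.
move=> rho0 rmin0 rr /andP[amin amax] B0 F0 Bf.
suff [D [mD DI Da Dy]] : exists D : set R, [/\ measurable D,
    D `<=` `[rmin, rmax], forall r, D r -> r != a &
    (\int[lebesgue_measure]_(r in D) (`|r - a|^-1)%:E = +oo)%E].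
  apply/eqP; rewrite -leye_eq.
  apply: le_trans (mean_function_ge (b := fun r => B * `|r - a|^-1)
    rho0 rmin0 F0 DI _ _).
  - under eq_integral do rewrite EFinM.
    rewrite ge0_integralZl_EFin ?(ltW B0)//; last exact: measurable_inv_dist.
    by rewrite Dy gt0_muley ?lte_fin// gt0_muley// lte_fin mean_constant_gt0.
  - by move=> r _; rewrite mulr_ge0 ?(ltW B0)// invr_ge0.
  - by move=> r /[dup] /Da ra /DI /=; rewrite in_itv/= => rI; exact: Bf.
(* Integrate to the right of [a] if there is room; otherwise [a] is [rmax] and the left side is
   used. *)
have [am|am] := ltP a rmax.
  exists `]a, (a + (rmax - a))[%classic; split => //.
  - move=> r /=; rewrite !in_itv/= => /andP[]; lra.
  - by move=> r /=; rewrite in_itv/= => /andP[ar _]; rewrite gt_eqF.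
  - by rewrite integral_inv_dist_right// subr_gt0.
exists `](a - (a - rmin)), a[%classic; split => //.
- move=> r /=; rewrite !in_itv/= => /andP[]; lra.
- by move=> r /=; rewrite in_itv/= => /andP[_ ra]; rewrite lt_eqF.
- rewrite integral_inv_dist_left// subr_gt0; lra.
Qed.

(** * Estimates uniform over the range of radii *)

Section droplets.
Context (R : realType) (rho mu g v w rmin rmax : R) (F : R -> R)
  (z : R -> R -> R).
Hypotheses (rho_gt0 : 0 < rho) (mu_gt0 : 0 < mu) (g_gt0 : 0 < g)
  (v_gt0 : 0 < v) (w_gt0 : 0 < w) (rmin_gt0 : 0 < rmin)
  (rmin_lt_rmax : rmin < rmax).
Hypothesis F_cont : {within `[rmin, rmax], continuous F}.
Hypothesis F_gt0 : forall r : R, rmin <= r <= rmax -> 0 < F r.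
Hypothesis z_motion : forall r : R, rmin <= r <= rmax ->
  droplet_motion rho mu g v w r (fun t => z t r).

Local Notation k := (drag_rate rho mu).
Local Notation c := (terminal_velocity rho mu g w).
Local Notation rcr := (critical_radius rho mu g w).
Local Notation m := (mean_function rho rmin rmax F z).

Lemma density_bounds : exists2 b : R * R, 0 < b.1 &
  forall r : R, rmin <= r <= rmax -> b.1 <= F r <= b.2.
Proof.
have [p pI pF] := EVT_min (ltW rmin_lt_rmax) F_cont.
have [q qI qF] := EVT_max (ltW rmin_lt_rmax) F_cont.
exists (F p, F q) => /= [|r rI]; first by apply: F_gt0; rewrite in_itv in pI.
by rewrite pF ?qF// in_itv.
Qed.

Lemma density_ge0 (r : R) : rmin <= r <= rmax -> 0 <= F r.
Proof. by move=> /F_gt0/ltW. Qed.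

Lemma radius_gt0 (r : R) : rmin <= r <= rmax -> 0 < r.
Proof. by move=> /andP[rr _]; exact: lt_le_trans rr. Qed.

Lemma heightE (r t : R) : rmin <= r <= rmax -> 0 <= t ->
  z t r = flight_height (k r) (c r) v t.
Proof.
move=> rr t0.
exact: (droplet_height rho_gt0 mu_gt0 (radius_gt0 rr) (z_motion rr) t0).
Qed.

Lemma drag_rate_rmax_gt0 : 0 < k rmax.
Proof. by apply: drag_rate_gt0 => //; exact: lt_trans rmin_lt_rmax. Qed.

(** The largest droplets have the slowest relaxation, so [k rmax] serves as the rate in all uniform
    bounds. *)
Lemma drag_rate_ge (r : R) : rmin <= r <= rmax -> k rmax <= k r.
Proof.
by move=> rr; apply: drag_rate_le (radius_gt0 rr) _ => //; case/andP: rr.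
Qed.

Lemma inv_drag_rate_le (r : R) : rmin <= r <= rmax -> (k r)^-1 <= (k rmax)^-1.
Proof.
move=> rr; rewrite lef_pV2 ?posrE ?drag_rate_rmax_gt0 ?drag_rate_ge//.
by apply: drag_rate_gt0 => //; exact: radius_gt0 rr.
Qed.

(** Factor rcr^2 - r^2 and use rcr + r <= 2 rmax and 1 / r^2 <= 1 / rmin^2. *)
Lemma drag_rate_terminal_velocity_le (r : R) :
  rcr <= rmax -> rmin <= r <= rmax ->
  k r * `|c r| <= g * (2 * rmax) / rmin ^+ 2 * `|r - rcr|.
Proof.
move=> cm rr; have r0 := radius_gt0 rr; have /andP[r1 r2] := rr.
have kc := drag_rate_terminal_velocity rho_gt0 mu_gt0 g_gt0 w_gt0 r0.
have rc0 : 0 <= rcr := sqrtr_ge0 _.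
have gr0 : 0 < g / r ^+ 2 by rewrite divr_gt0 ?exprn_gt0.
rewrite -[k r]gtr0_norm ?drag_rate_gt0// -normrM kc subr_sqr.
rewrite normrM (gtr0_norm gr0) normrM (distrC rcr).
rewrite [`|rcr + r|]ger0_norm; last lra.
rewrite mulrCA mulrC ler_wpM2r// mulrAC -!mulrA ler_wpM2l ?(ltW g_gt0)//.
rewrite [leRHS]mulrA [leLHS]mulrC [leRHS]mulrC.
have i1 : r ^- 2 <= rmin ^- 2.
  by rewrite lef_pV2 ?posrE ?exprn_gt0// ler_gt0X.
have i0 : 0 <= r ^- 2 by rewrite invr_ge0 exprn_ge0// ltW.
have i2 : 0 <= rcr + r by lra.
by apply: ler_pM => //; lra.
Qed.

(** * The critical regime *)

(** With k |c| <= M |r - rcr|, the condition k |c| t < v holds up to t = v / (M |r - rcr|), and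
    until then the droplet stays in ]0, x]. *)
Lemma critical_mean_infinite (x : R) : rmin <= rcr <= rmax ->
  2 * (v / k rmax) <= x -> m x = +oo%E.
Proof.
move=> crr xk; have [/= [f1 f2] /= f10 Ff] := density_bounds.
pose M := g * (2 * rmax) / rmin ^+ 2.
have rmax_gt0 : 0 < rmax by exact: lt_trans rmin_lt_rmax.
have M0 : 0 < M by rewrite /M divr_gt0 ?exprn_gt0// mulr_gt0// mulr_gt0.
apply: (@mean_function_eq_pinfty _ _ _ _ _ _ _ rcr (rmin ^+ 3 * f1 * (v / M)))
    => // [|r /density_ge0//|r rr rc].
  by rewrite !mulr_gt0 ?invr_gt0 ?exprn_gt0.
have r0 := radius_gt0 rr; have k0 := drag_rate_gt0 rho_gt0 mu_gt0 r0.
have D0 : 0 < `|r - rcr| by rewrite normr_gt0 subr_eq0.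
have T0 : 0 < v / M / `|r - rcr| by rewrite !mulr_gt0 ?invr_gt0.
have fF : 0 <= F r := density_ge0 rr.
apply: (@le_trans _ _ (r ^+ 3 * F r * (v / M / `|r - rcr|))%:E).
  have /andP[r1 r2] := rr; have /andP[F1 F2] := Ff _ rr.
  rewrite lee_fin -mulrA ler_wpM2r ?(ltW T0)//.
  by apply: ler_pM; rewrite ?ler_gt0X// ?exprn_ge0 ?ltW.
apply: flight_integral_ge => // [||t /andP[t0 tT]]; [exact: ltW|exact: ltW|].
have kct : k r * `|c r| * t < v.
  apply: (@le_lt_trans _ _ (M * `|r - rcr| * t)).
    rewrite ler_pM2r//; apply: drag_rate_terminal_velocity_le => //.
    by case/andP: crr.
  have MD0 : 0 < M * `|r - rcr| by rewrite mulr_gt0.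
  by rewrite mulrC -ltr_pdivlMr// invfM mulrA.
rewrite (heightE rr (ltW t0)) flight_height_gt0//=.
apply: le_trans (flight_height_le _ k0 v_gt0 (ltW t0)) _.
apply: le_trans xk.
(* The two terms of the height bound are each at most v / k, whence the factor 2 in the threshold on
   x. *)
have h1 : `|c r| * t <= v / k r.
  by rewrite ler_pdivlMr// mulrC mulrA ltW.
have h2 : v / k r <= v / k rmax.
  by rewrite ler_pM2l// inv_drag_rate_le.
lra.
Qed.

(** * Sign of the terminal velocity away from the critical radius *)

(** As [c] decreases with the radius, its sign at [rmax] gives a uniform positive lower bound; the
    next lemma uses [rmin] in the same way for a negative upper bound. *)
Lemma supercritical_terminal_velocity_gt0 : rmax < rcr -> 0 < c rmax.
Proof.
move=> mc; have rmax_gt0 : 0 < rmax by exact: lt_trans rmin_lt_rmax.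
rewrite -(pmulr_rgt0 _ drag_rate_rmax_gt0) drag_rate_terminal_velocity//.
rewrite mulr_gt0 ?divr_gt0 ?exprn_gt0// subr_gt0 ltr_pXn2r ?nnegrE//;
  apply: ltW => //.
exact: lt_trans mc.
Qed.

Lemma subcritical_terminal_velocity_lt0 : rcr < rmin -> c rmin < 0.
Proof.
move=> cm.
rewrite -(pmulr_rlt0 _ (drag_rate_gt0 rho_gt0 mu_gt0 rmin_gt0)).
rewrite drag_rate_terminal_velocity//.
rewrite pmulr_rlt0 ?divr_gt0 ?exprn_gt0// subr_lt0.
rewrite ltr_pXn2r ?nnegrE ?sqrtr_ge0//.
exact: ltW.
Qed.

(** * The supercritical regime: linear growth of the mean *)

(** The height is at least s t with s = min(c rmax, v), so a height of at most x forces t <= x /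
    s. *)
Lemma supercritical_mean_le : rmax < rcr ->
  exists2 B : R, 0 <= B & forall x : R, 0 < x -> (m x <= (B * x)%:E)%E.
Proof.
move=> mc; have [/= [f1 f2] /= f10 Ff] := density_bounds.
have c0 := supercritical_terminal_velocity_gt0 mc.
pose s := Num.min (c rmax) v.
have s0 : 0 < s by rewrite lt_min c0.
have f20 : 0 < f2.
  have /andP[F1 F2] : f1 <= F rmin <= f2 by apply: Ff; rewrite lexx ltW.
  exact: lt_le_trans f10 (le_trans F1 F2).
have rmax_gt0 : 0 < rmax by exact: lt_trans rmin_lt_rmax.
exists (4 / 3 * pi * rho * (rmax ^+ 3 * f2 / s * (rmax - rmin))).
  by rewrite ltW// !mulr_gt0 ?invr_gt0 ?exprn_gt0 ?pi_gt0 ?subr_gt0.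
move=> x x0.
have := @mean_function_le R rho rmin rmax F z x (rmax ^+ 3 * f2 * (x / s))
  rho_gt0 rmin_gt0 (ltW rmin_lt_rmax) density_ge0.
move=> /(_ _ _)/le_trans; apply => [|r rr|].
- by rewrite !mulr_ge0 ?invr_ge0 ?exprn_ge0 ?ltW.
- have r0 := radius_gt0 rr; have k0 := drag_rate_gt0 rho_gt0 mu_gt0 r0.
  have /andP[r1 r2] := rr; have /andP[F1 F2] := Ff _ rr.
  have F0 := density_ge0 rr.
  apply: (@le_trans _ _ (r ^+ 3 * F r * (x / s))%:E); last first.
    rewrite lee_fin ler_wpM2r//; first by rewrite ltW// divr_gt0.
    by apply: ler_pM; rewrite ?ler_gt0X// ?exprn_ge0 ?ltW.
  apply: flight_integral_le => //; [exact: ltW|by rewrite ltW// divr_gt0|].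
  move=> t [t0 _] /andP[z0 zx]; rewrite ler_pdivlMr// mulrC.
  have [->|tn0] := eqVneq t 0; first by rewrite mulr0 ltW.
  apply: le_trans zx; rewrite heightE//; apply: flight_height_ge_linear => //.
  + apply: (@le_trans _ _ (c rmax)); first by rewrite ge_min lexx.
    exact: terminal_velocity_le.
  + by rewrite ge_min lexx orbT.
  + by rewrite lt_def tn0.
- rewrite lee_fin le_eqVlt; apply/orP; left; apply/eqP; field.
  exact: lt0r_neq0.
Qed.

(** Both c <= w and v are at most w + v, so the height is at most (w + v) t and the droplet stays in
    ]0, x] until time x / (w + v). *)
Lemma supercritical_mean_ge : rmax < rcr ->
  exists2 B : R, 0 < B & forall x : R, 0 < x -> ((B * x)%:E <= m x)%E.
Proof.
move=> mc; have [/= [f1 f2] /= f10 Ff] := density_bounds.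
have c0 := supercritical_terminal_velocity_gt0 mc.
have s0 : 0 < w + v by rewrite addr_gt0.
exists (4 / 3 * pi * rho * (rmin ^+ 3 * f1 / (w + v) * (rmax - rmin))).
  rewrite mulr_gt0 ?mean_constant_gt0//.
  by rewrite !mulr_gt0 ?invr_gt0 ?exprn_gt0// subr_gt0.
move=> x x0.
apply: le_trans (mean_function_ge (D := `[rmin, rmax]%classic)
  (b := fun=> rmin ^+ 3 * f1 * (x / (w + v)))
  rho_gt0 rmin_gt0 density_ge0 _ _ _) => //.
- rewrite (integral_cst_segment _ (ltW rmin_lt_rmax)) -EFinM lee_fin.
  rewrite le_eqVlt; apply/orP; left; apply/eqP; field; exact: lt0r_neq0.
- by move=> r _; rewrite !mulr_ge0 ?invr_ge0 ?exprn_ge0 ?ltW.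
move=> r /=; rewrite in_itv/= => rr.
have r0 := radius_gt0 rr; have k0 := drag_rate_gt0 rho_gt0 mu_gt0 r0.
have /andP[r1 r2] := rr; have /andP[F1 F2] := Ff _ rr.
have F0 := density_ge0 rr.
have cr0 : 0 < c r by apply: lt_le_trans c0 _; exact: terminal_velocity_le.
apply: (@le_trans _ _ (r ^+ 3 * F r * (x / (w + v)))%:E).
  rewrite lee_fin ler_wpM2r//; first by rewrite ltW// divr_gt0.
  by apply: ler_pM; rewrite ?ler_gt0X// ?exprn_ge0 ?ltW.
apply: flight_integral_ge => //; [exact: ltW|by rewrite ltW// divr_gt0|].
move=> t /andP[t0]; rewrite ltr_pdivlMr// mulrC => tx.
rewrite (heightE rr (ltW t0)); apply/andP; split.
  have s1 : 0 < Num.min (c r) v * t by rewrite mulr_gt0// lt_min cr0.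
  apply: lt_le_trans s1 _; apply: flight_height_ge_linear => //.
    by rewrite ge_min lexx.
  by rewrite ge_min lexx orbT.
apply: le_trans (ltW tx); apply: flight_height_le_linear => //.
  have gk : 0 <= g / k r by rewrite ltW// divr_gt0.
  by rewrite /terminal_velocity lerD// (le_trans _ (ltW v_gt0))// oppr_le0.
by rewrite lerDr ltW.
Qed.

(** * The subcritical regime: bounded flights *)

(** The zero in t of v / k - s (t - 1 / k) for the slowest rate k = [k rmax] and the smallest
    falling speed s = [- c rmin]. *)
Local Notation Tmax := ((k rmax)^-1 + v / k rmax / - c rmin).

Lemma subcritical_Tmax_gt0 : rcr < rmin -> 0 < Tmax.
Proof.
move=> /subcritical_terminal_velocity_lt0 c0.
by rewrite addr_gt0 ?mulr_gt0 ?invr_gt0 ?drag_rate_rmax_gt0 ?oppr_gt0.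
Qed.

Lemma subcritical_velocity_le (r : R) : rmin <= r <= rmax -> c r <= c rmin.
Proof. by move=> /andP[r1 r2]; exact: terminal_velocity_le. Qed.

Lemma subcritical_height_le (r t : R) : rcr < rmin -> rmin <= r <= rmax ->
  0 <= t -> z t r <= v / k rmax.
Proof.
move=> cm rr t0; have k0 := drag_rate_gt0 rho_gt0 mu_gt0 (radius_gt0 rr).
have c0 := subcritical_terminal_velocity_lt0 cm.
have [->|tn0] := eqVneq t 0.
  have [? [? [-> _ _ _ _]]] := z_motion rr.
  by rewrite divr_ge0 ?ltW ?drag_rate_rmax_gt0.
rewrite heightE//; apply: (@le_trans _ _ (v / k r)).
  apply: flight_height_le_bounded => //; last by rewrite lt_def tn0.
  exact: le_trans (subcritical_velocity_le rr) (ltW c0).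
by rewrite ler_pM2l// inv_drag_rate_le.
Qed.

Lemma subcritical_height_le0 (r t : R) : rcr < rmin -> rmin <= r <= rmax ->
  Tmax <= t -> z t r <= 0.
Proof.
move=> cm rr tT; have k0 := drag_rate_gt0 rho_gt0 mu_gt0 (radius_gt0 rr).
have c0 := subcritical_terminal_velocity_lt0 cm.
have t0 : 0 < t := lt_le_trans (subcritical_Tmax_gt0 cm) tT.
have s0 : 0 < - c rmin by rewrite oppr_gt0.
rewrite (heightE rr (ltW t0)).
apply: le_trans (flight_height_le_falling k0 v_gt0 (ltW s0) _ t0) _.
  by rewrite opprK subcritical_velocity_le.
rewrite subr_le0 [leRHS]mulrC -ler_pdivrMr//.
rewrite lerBrDl; apply: le_trans tT; rewrite lerD ?inv_drag_rate_le//.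
by rewrite ler_pM2r ?invr_gt0// ler_pM2l// inv_drag_rate_le.
Qed.

(** The height is positive early on and at most 0 at [Tmax], so the intermediate value theorem
    yields a return time. *)
Lemma subcritical_duration (r : R) : rcr < rmin -> rmin <= r <= rmax ->
  exists2 s : R, 0 <= s <= Tmax & duration z r = s%:E.
Proof.
move=> cm rr; have k0 := drag_rate_gt0 rho_gt0 mu_gt0 (radius_gt0 rr).
have T0 := subcritical_Tmax_gt0 cm.
have cr0 : c r < 0.
  exact: le_lt_trans (subcritical_velocity_le rr)
    (subcritical_terminal_velocity_lt0 cm).
have K0 : 0 < k r * `|c r| by rewrite mulr_gt0// normr_gt0 lt_eqF.
(* Half of the time v / (k |c|) before which positivity is guaranteed. *)
pose t0 := v / (k r * `|c r|) / 2.
have t0_gt0 : 0 < t0 by rewrite !divr_gt0.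
have zt0 : 0 < z t0 r.
  rewrite (heightE rr (ltW t0_gt0)); apply: flight_height_gt0 => //.
  rewrite mulrC -ltr_pdivlMr// /t0 ltr_pdivrMr// ltr_pMr ?divr_gt0//.
  by rewrite ltr1n.
have t0T : t0 <= Tmax.
  rewrite leNgt; apply/negP => /ltW /(subcritical_height_le0 cm rr).
  by rewrite leNgt zt0.
(* Starting from [t0] rather than 0 excludes the launch itself, which is also a zero of the
   height. *)
have [s sI zs] : exists2 s, s \in `[t0, Tmax] & z s r = 0.
  apply: (@IVT R (fun t => z t r)) => //.
    apply: (droplet_within_continuous (z_motion rr)) => t /=.
    by rewrite !in_itv/= andbT => /andP[ts _]; rewrite (le_trans (ltW t0_gt0)).
  have zT := subcritical_height_le0 cm rr (lexx Tmax).
  by rewrite ge_min zT orbT le_max (ltW zt0).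
have dur0 : (0 <= duration z r)%E.
  by apply/ereal_infP => _ [x [x0 _] <-]; rewrite lee_fin ltW.
have durT : (duration z r <= Tmax%:E)%E.
  move: sI; rewrite in_itv/= => /andP[s1 s2].
  apply: ge_ereal_inf; exists s%:E => //; exists s => //.
  by split => //; exact: lt_le_trans s1.
have durf : duration z r \is a fin_num.
  by rewrite ge0_fin_numE// (le_lt_trans durT)// ltry.
exists (fine (duration z r)); last by rewrite fineK.
by rewrite -!lee_fin fineK// dur0.
Qed.

(** The flight times form a compact interval, on which the continuous height attains its maximum; a
    choice function collects these maxima. *)
Lemma subcritical_max_height : rcr < rmin ->
  exists H : R -> R,
    (forall r : R, rmin <= r <= rmax ->
       is_max_on (flight_times z r) (fun t => z t r) (H r)) /\
    [bounded H r | r in `[rmin, rmax]].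
Proof.
move=> cm.
have : forall r : R, exists h : R, rmin <= r <= rmax ->
    is_max_on (flight_times z r) (fun t => z t r) h.
  move=> r; have [rr|rr] := boolP (rmin <= r <= rmax); last by exists 0.
  have [s /andP[s0 sT] durE] := subcritical_duration cm rr.
  have [|p pI pmax] := @EVT_max R (fun t => z t r) 0 s s0.
    apply: (droplet_within_continuous (z_motion rr)) => t /=.
    by rewrite !in_itv/= andbT => /andP[].
  exists (z p r) => _; split.
    exists p => //; move: pI; rewrite in_itv/= => /andP[p0 ps].
    by split => //; rewrite durE lee_fin.
  move=> t [t0]; rewrite durE lee_fin => ts.
  by apply: pmax; rewrite in_itv/= t0.
move=> /choice[H Hmax]; exists H; split => //.
exists (v / k rmax); split; first exact: num_real.
move=> M HM r /=; rewrite in_itv/= => rr; apply: le_trans (ltW HM).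
have [[t [t0 _] <-] zle] := Hmax r rr.
rewrite ger0_norm; first exact: subcritical_height_le.
have [dh [ddh [z0 _ _ _ _]]] := z_motion rr.
have := zle 0; rewrite z0 => H0.
have [s /andP[s0 sT] durE] := subcritical_duration cm rr.
by apply: H0; split => //; rewrite durE lee_fin.
Qed.

(** All flights end by [Tmax], which bounds the inner integral uniformly in the radius and in x. *)
Lemma subcritical_mean_bounded : rcr < rmin ->
  exists M : R, forall x : R, 0 < x -> (`|m x| <= M%:E)%E.
Proof.
move=> cm; have [/= [f1 f2] /= f10 Ff] := density_bounds.
have rmax_gt0 : 0 < rmax by exact: lt_trans rmin_lt_rmax.
have T0 := subcritical_Tmax_gt0 cm.
have f20 : 0 < f2.
  have /andP[F1 F2] : f1 <= F rmin <= f2 by apply: Ff; rewrite lexx ltW.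
  exact: lt_le_trans f10 (le_trans F1 F2).
exists (4 / 3 * pi * rho * (rmax ^+ 3 * f2 * Tmax * (rmax - rmin))) => x x0.
rewrite gee0_abs; last by apply: mean_function_ge0 => //; exact: density_ge0.
apply: mean_function_le density_ge0 _ _ => // [||r rr]; first exact: ltW.
  by rewrite ltW// mulr_gt0// mulr_gt0 ?exprn_gt0.
have r0 := radius_gt0 rr; have F0 := density_ge0 rr.
have /andP[r1 r2] := rr; have /andP[F1 F2] := Ff _ rr.
apply: (@le_trans _ _ (r ^+ 3 * F r * Tmax)%:E).
  apply: flight_integral_le => //; [exact: ltW|exact: ltW|].
  have [s /andP[s0 sT] durE] := subcritical_duration cm rr.
  by move=> t [t0]; rewrite durE lee_fin => ts _; exact: le_trans sT.
rewrite lee_fin ler_wpM2r//; first exact: ltW.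
by apply: ler_pM; rewrite ?ler_gt0X// ?exprn_ge0 ?ltW.
Qed.

(** No droplet rises above v / k rmax, so at every height reached the two indicator functions
    agree. *)
Lemma subcritical_mean_const (x : R) : rcr < rmin -> v / k rmax <= x ->
  m x = m (v / k rmax).
Proof.
move=> cm xk; rewrite /mean_function; congr (_ * _)%E.
apply: eq_integral => r; rewrite inE/= in_itv/= => rr.
apply: eq_integral => t; rewrite inE => -[t0 _].
congr (_ * _ * _)%:E; rewrite !indicE; congr (_%:R); apply: congr1.
have zk := subcritical_height_le cm rr t0.
by apply/idP/idP; rewrite !inE/= !in_itv/= zk (le_trans zk xk).
Qed.

End droplets.

(** * Assembly of the three regimes *)

Theorem mainTheorem3 (R : realType) (rho mu g v w rmin rmax : R)
    (F : R -> R) (z : R -> R -> R)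
    (rho_gt0 : 0 < rho) (mu_gt0 : 0 < mu) (g_gt0 : 0 < g)
    (v_gt0 : 0 < v) (w_gt0 : 0 < w)
    (rmin_gt0 : 0 < rmin) (rmin_lt_rmax : rmin < rmax)
    (F_cont : {within `[rmin, rmax], continuous F})
    (F_gt0 : forall r : R, rmin <= r <= rmax -> 0 < F r)
    (F_out : forall r : R, ~~ (rmin <= r <= rmax) -> F r = 0)
    (z_motion : forall r : R, rmin <= r <= rmax ->
       droplet_motion rho mu g v w r (fun t => z t r)) :
  let rcr := critical_radius rho mu g w in
  let m := mean_function rho rmin rmax F z in
  [/\ rcr < rmin ->
        [/\ forall r : R, rmin <= r <= rmax -> (duration z r < +oo)%E,
            exists H : R -> R,
              (forall r : R, rmin <= r <= rmax ->
                 is_max_on (flight_times z r) (fun t => z t r) (H r)) /\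
              [bounded H r | r in `[rmin, rmax]],
            exists M : R, forall x : R, 0 < x -> (`|m x| <= M%:E)%E
          & exists c : \bar R, \forall x \near +oo, m x = c],
      rmin <= rcr <= rmax ->
        \forall x \near +oo, m x = +oo%E
    & rmax < rcr ->
        (forall x : R, 0 < x -> (m x < +oo)%E) /\
        m x @[x --> +oo] --> +oo%E].
Proof.
move=> rcr m; split => [cm|crr|mc].
- split.
  + move=> r rr; have [s _ ->] := subcritical_duration rho_gt0 mu_gt0 g_gt0
      v_gt0 w_gt0 rmin_gt0 rmin_lt_rmax z_motion cm rr.
    exact: ltry.
  + exact: (subcritical_max_height rho_gt0 mu_gt0 g_gt0 v_gt0 w_gt0 rmin_gt0
      rmin_lt_rmax z_motion cm).
  + exact: (subcritical_mean_bounded rho_gt0 mu_gt0 g_gt0 v_gt0 w_gt0 rmin_gt0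
      rmin_lt_rmax F_cont F_gt0 z_motion cm).
  + exists (m (v / drag_rate rho mu rmax)).
    exists (v / drag_rate rho mu rmax); split; first exact: num_real.
    move=> x /ltW xk; exact: (subcritical_mean_const F rho_gt0 mu_gt0 g_gt0
      v_gt0 w_gt0 rmin_gt0 rmin_lt_rmax z_motion cm xk).
- exists (2 * (v / drag_rate rho mu rmax)); split; first exact: num_real.
  move=> x /ltW xk; exact: (critical_mean_infinite rho_gt0 mu_gt0 g_gt0
    v_gt0 w_gt0 rmin_gt0 rmin_lt_rmax F_cont F_gt0 z_motion crr xk).
- have [B _ Bx] := supercritical_mean_le rho_gt0 mu_gt0 g_gt0 v_gt0 w_gt0
    rmin_gt0 rmin_lt_rmax F_cont F_gt0 z_motion mc.
  have [b b0 bx] := supercritical_mean_ge rho_gt0 mu_gt0 g_gt0 v_gt0 w_gt0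
    rmin_gt0 rmin_lt_rmax F_cont F_gt0 z_motion mc.
  split=> [x /Bx mx|]; first exact: le_lt_trans mx (ltry _).
  (* Beyond A / b the lower bound b x exceeds A; the maximum with 0 ensures x > 0, where that bound
     is available. *)
  apply/cvgeyPge => A; exists (Num.max 0 (A / b)); split; first exact: num_real.
  move=> x; rewrite gt_max => /andP[x0 Ax]; apply: le_trans (bx x x0).
  by rewrite lee_fin mulrC -ler_pdivrMr// ltW.
Qed.
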